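(* Let $T\ge 2$ and $n\ge 2$ be integers, both odd, with $n\le 2T-1$, and let $V$ be the value of the periodic patrolling game on the line graph $L_n$ with period $T$ and attack duration $2$. Then $$V=\frac{2}{n+1}.$$ The independent attack strategy is optimal for the Attacker, and there is an optimal strategy for the Patroller that is a probabilistic choice (a probability mixture) of biased oscillations.
   Context: The line graph $L_n$ is the graph with node set $\{1,2,\dots,n\}$ and edges $\{i,i+1\}$ for $i=1,\dots,n-1$ (the path on $n$ nodes). The periodic patrolling game on a graph $Q$ with node set $N$, period $T$ and attack duration $2$ is the following finite zero-sum game. Times form the time circle $\{1,2,\dots,T\}$ with arithmetic modulo $T$. A pure strategy of the Patroller (a patrol) is a walk $w:\{1,2,\ldots\}\to N$ such that $w(t)$ and $w(t+1)$ are the same or adjacent nodes and $w(t+T)=w(t)$ for all $t$. A pure strategy of the Attacker is a pair consisting of a node $i\in N$ and an attack interval $J=\{t,t+1\}$ of two consecutive times (modulo $T$). The patrol $w$ intercepts the attack if $w(s)=i$ for some $s\in J$; the payoff (to the Patroller, who maximizes; the Attacker minimizes) is $1$ if the attack is intercepted and $0$ otherwise. Both players may use mixed strategies; $V$ is the value of the game (expected payoff under optimal play). The independent attack strategy is the mixed Attacker strategy that fixes a time interval $\{t,t+1\}$ and attacks during it at a node chosen equiprobably from a maximum-cardinality set of pairwise non-adjacent nodes (for $L_n$ with $n$ odd, the odd-numbered nodes). Biased oscillations ($T=2q+1$ odd): for $p\in[0,1]$ and $i\in\{1,\dots,n-1\}$, a right $p$-biased oscillation $\overrightarrow{b}_p(i)$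 is the randomized $T$-periodic walk on the two nodes $i,i+1$ in which the two nodes alternate, except that with probability $p$ the right-hand node $i+1$ is repeated at two consecutive times (so the walk is at $i+1$ for $q+1$ periods and at $i$ for $q$ periods), and with probability $1-p$ the left-hand node $i$ is repeated at two consecutive times; in either case the time (modulo $T$) of the repetition is chosen uniformly at random. A left $p$-biased oscillation is $\overleftarrow{b}_p(i)=\overrightarrow{b}_{1-p}(i)$. A biased oscillation is any such left or right $p$-biased oscillation. *)

(* Defs.v *)
From mathcomp Require Import all_boot all_order all_algebra.
From mathcomp Require Import classical_sets reals.

Set Implicit Arguments.
Unset Strict Implicit.
Unset Printing Implicit Defensive.

Import Order.TTheory GRing.Theory Num.Theory.
Local Open Scope ring_scope.

(* Finite two-person zero-sum games: [u a b] is what the row player (the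
   maximizer) receives from the column player (the minimizer). *)
Section ZeroSumGame.
Variables (R : realType) (A B : finType) (u : A -> B -> R).

Definition mixed (C : finType) (x : {ffun C -> R}) : Prop :=
  (forall c, 0 <= x c) /\ \sum_c x c = 1.

Definition expected_payoff (x : {ffun A -> R}) (y : {ffun B -> R}) : R :=
  \sum_a \sum_b x a * y b * u a b.

Definition max_guarantee (x : {ffun A -> R}) : R :=
  inf [set v | exists2 y, mixed y & v = expected_payoff x y]%classic.

Definition min_guarantee (y : {ffun B -> R}) : R :=
  sup [set v | exists2 x, mixed x & v = expected_payoff x y]%classic.

Definition lower_value : R :=
  sup [set v | exists2 x, mixed x & v = max_guarantee x]%classic.

Definition upper_value : R :=
  inf [set v | exists2 y, mixed y & v = min_guarantee y]%classic.

Definition is_value (V : R) : Prop := lower_value = V /\ upper_value = V.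

Definition optimal_max (x : {ffun A -> R}) : Prop :=
  mixed x /\ max_guarantee x = lower_value.

Definition optimal_min (y : {ffun B -> R}) : Prop :=
  mixed y /\ min_guarantee y = upper_value.

End ZeroSumGame.

(* The time circle is ['I_T], with [ordS] as the successor modulo [T]; a
   T-periodic walk is given by its restriction to one period.  The graph is
   given by its adjacency relation [e] on the finite node type [N]. *)
Section Patrolling.
Variables (R : realType) (T : nat) (N : finType) (e : rel N).

Definition is_walk (w : {ffun 'I_T -> N}) : bool :=
  [forall t, (w (ordS t) == w t) || e (w t) (w (ordS t))].

Definition patrol : finType := {w : {ffun 'I_T -> N} | is_walk w}.

(* [(i, t)] is the attack at node [i] during the interval {t, t+1}. *)
Definition attack : finType := (N * 'I_T)%type.

Definition intercepts (w : patrol) (a : attack) : bool :=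
  (val w a.2 == a.1) || (val w (ordS a.2) == a.1).

Definition patrol_payoff (w : patrol) (a : attack) : R := (intercepts w a)%:R.

Definition independent (S : {set N}) : bool :=
  [forall i in S, forall j in S, ~~ e i j].

Definition max_independent (S : {set N}) : Prop :=
  independent S /\ forall S' : {set N}, independent S' -> (#|S'| <= #|S|)%N.

Definition independent_attack (t : 'I_T) (S : {set N}) : {ffun attack -> R} :=
  [ffun a => if (a.1 \in S) && (a.2 == t) then #|S|%:R^-1 else 0].

(* [w] alternates between [l] and [r], except that it is at [a] at both times
   [s] and [s + 1].  For [T] odd, [l], [r] adjacent and distinct, and
   [a \in {l, r}], exactly one patrol has this property for each [s]. *)
Definition oscillates (l r a : N) (s : 'I_T) (w : patrol) : bool :=
  [&& [forall t, (val w t == l) || (val w t == r)],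
      val w s == a, val w (ordS s) == a
    & [forall t, (t != s) ==> (val w (ordS t) != val w t)]].

(* Here [l] is the left-hand node and [r] the right-hand one; the node to be
   repeated and the uniform repetition time [s] are chosen independently. *)
Definition right_osc (p : R) (l r : N) : {ffun patrol -> R} :=
  [ffun w => \sum_(s < T) T%:R^-1 *
     (p * (oscillates l r r s w)%:R + (1 - p) * (oscillates l r l s w)%:R)].

Definition left_osc (p : R) (l r : N) : {ffun patrol -> R} :=
  right_osc (1 - p) l r.

End Patrolling.

(* Nodes are numbered from 0: the ordinal [i] is the node i + 1. *)
Definition line_edge (n : nat) : rel 'I_n :=
  fun i j => (j == i.+1 :> nat) || (i == j.+1 :> nat).

Arguments line_edge : clear implicits.

Section LineOscillations.
Variables (R : realType) (T n : nat).

Definition biased_oscillation (x : {ffun patrol T (line_edge n) -> R}) : Prop :=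
  exists (p : R) (l r : 'I_n),
    [/\ 0 <= p <= 1, r = l.+1 :> nat
      & x = right_osc T (line_edge n) p l r \/
        x = left_osc T (line_edge n) p l r].

Definition oscillation_mixture (x : {ffun patrol T (line_edge n) -> R}) : Prop :=
  exists (k : nat) (c : {ffun 'I_k -> R})
    (b : 'I_k -> {ffun patrol T (line_edge n) -> R}),
    [/\ mixed c, forall j, biased_oscillation (b j)
      & forall w, x w = \sum_j c j * b j w].

End LineOscillations.

(* Main.v *)
Require Import Defs.
From mathcomp Require Import all_boot all_order all_algebra.
From mathcomp Require Import classical_sets reals.
From mathcomp Require Import zify ring lra.

Set Implicit Arguments.
Unset Strict Implicit.
Unset Printing Implicit Defensive.

Import Order.TTheory GRing.Theory Num.Theory.
Local Open Scope ring_scope.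

(* Number the nodes 0, ..., n-1 and put m = (n+1)/2, so that m <= T.  A patrol
   meets at most one node of an independent set during a given attack interval,
   and the even nodes form an independent set of size m: the Attacker concedes
   at most 1/m.  An oscillation on {j, j+1} that repeats one of its two nodes
   intercepts every attack at that node and a fraction 1 - 1/T of the attacks
   at the other one.  Repeating always the even node, and giving the edges
   {2k, 2k+1} and {2k+1, 2k+2} weights T-1-k and k+1, each node but the last
   is covered with total weight exactly T-1.  Since m <= T, enough of the total
   weight m(T-1) is left to raise the last edge to weight T-1, which covers the
   last node; normalizing, the Patroller guarantees (T-1)/(m(T-1)) = 1/m. *)

(** * Saddle points of finite zero-sum games *)

Section SaddlePoint.
Variables (R : realType) (A B : finType) (u : A -> B -> R).

Lemma mixed_avg_ge (C : finType) (x : {ffun C -> R}) (f : C -> R) (v : R) :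
  mixed x -> (forall c, v <= f c) -> v <= \sum_c x c * f c.
Proof.
move=> [x0 x1] vf; rewrite -[v]mul1r -x1 mulr_suml.
by apply: ler_sum => c _; rewrite ler_wpM2l.
Qed.

Lemma mixed_avg_le (C : finType) (x : {ffun C -> R}) (f : C -> R) (v : R) :
  mixed x -> (forall c, f c <= v) -> \sum_c x c * f c <= v.
Proof.
move=> [x0 x1] vf; rewrite -[leRHS]mul1r -x1 mulr_suml.
by apply: ler_sum => c _; rewrite ler_wpM2l.
Qed.

Lemma expected_payoffEl (x : {ffun A -> R}) (y : {ffun B -> R}) :
  expected_payoff u x y = \sum_a x a * \sum_b y b * u a b.
Proof.
by apply: eq_bigr => a _; rewrite mulr_sumr;
  apply: eq_bigr => b _; rewrite mulrA.
Qed.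

Lemma expected_payoffEr (x : {ffun A -> R}) (y : {ffun B -> R}) :
  expected_payoff u x y = \sum_b y b * \sum_a x a * u a b.
Proof.
rewrite /expected_payoff exchange_big; apply: eq_bigr => b _ /=.
by rewrite mulr_sumr; apply: eq_bigr => a _; rewrite mulrA [x a * y b]mulrC.
Qed.

(** A real [sup] or [inf] is meaningful only on a bounded set; this bound supplies the missing side
    for every guarantee below. *)
Lemma expected_payoff_bounded :
  exists M, forall x y, mixed x -> mixed y -> `|expected_payoff u x y| <= M.
Proof.
exists (\sum_a \sum_b `|u a b|) => x y mx my.
have ub a b : `|u a b| <= \sum_a \sum_b `|u a b|.
  rewrite (bigD1 a) //= (bigD1 b) //= -addrA lerDl addr_ge0 //.
    by apply: sumr_ge0.
  by apply: sumr_ge0 => ? _; apply: sumr_ge0.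
rewrite ler_norml expected_payoffEl; apply/andP; split.
  apply: mixed_avg_ge => // a; apply: mixed_avg_ge => // b.
  by have := ub a b; rewrite ler_norml => /andP[].
apply: mixed_avg_le => // a; apply: mixed_avg_le => // b.
by have := ub a b; rewrite ler_norml => /andP[].
Qed.

(** Pure replies suffice because a mixed reply only averages them. Playing against [y] caps the
    guarantee of every [x'] at [V], and playing against [x] bounds that of every [y'] from below, so
    both values are pinched at [V]. *)
Lemma saddle_point (x : {ffun A -> R}) (y : {ffun B -> R}) (V : R) :
  mixed x -> mixed y ->
  (forall b, V <= \sum_a x a * u a b) -> (forall a, \sum_b y b * u a b <= V) ->
  [/\ is_value u V, optimal_max u x & optimal_min u y].
Proof.
move=> mx my Vx Vy; have [M EM] := expected_payoff_bounded.
have xV y' : mixed y' -> V <= expected_payoff u x y'.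
  by move=> my'; rewrite expected_payoffEr; apply: mixed_avg_ge.
have yV x' : mixed x' -> expected_payoff u x' y <= V.
  by move=> mx'; rewrite expected_payoffEl; apply: mixed_avg_le.
have gx : V <= max_guarantee u x.
  apply: lb_le_inf; first by exists (expected_payoff u x y), y.
  by move=> _ [y' my' ->]; apply: xV.
have gy : min_guarantee u y <= V.
  apply: ge_sup; first by exists (expected_payoff u x y), x.
  by move=> _ [x' mx' ->]; apply: yV.
have gx' x' : mixed x' -> max_guarantee u x' <= V.
  move=> mx'; apply: le_trans (yV _ mx'); apply: ge_inf; last by exists y.
  exists (- M) => _ [y' my' ->].
  by have := EM _ _ mx' my'; rewrite ler_norml => /andP[].
have gy' y' : mixed y' -> V <= min_guarantee u y'.
  move=> my'; apply: le_trans (xV _ my') _; apply: ub_le_sup; last by exists x.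
  exists M => _ [x' mx' ->].
  by have := EM _ _ mx' my'; rewrite ler_norml => /andP[].
have eqx : max_guarantee u x = V by apply/le_anti; rewrite gx gx'.
have eqy : min_guarantee u y = V by apply/le_anti; rewrite gy gy'.
have lV : lower_value u = V.
  apply/le_anti/andP; split.
    by apply: ge_sup; [exists V, x | move=> _ [x' mx' ->]; apply: gx'].
  by apply: ub_le_sup; [exists V => _ [x' mx' ->]; apply: gx' | exists x].
have uV : upper_value u = V.
  apply/le_anti/andP; split.
    by apply: ge_inf; [exists V => _ [y' my' ->]; apply: gy' | exists y].
  by apply: lb_le_inf; [exists V, y | move=> _ [y' my' ->]; apply: gy'].
by split; split=> //; rewrite ?lV ?uV.
Qed.

End SaddlePoint.

(** * What the Attacker concedes on an independent set *)

Section IndependentAttack.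
Variables (R : realType) (T : nat) (N : finType) (e : rel N).

Lemma independent_attack_sum (t : 'I_T) (S : {set N}) (f : attack T N -> R) :
  \sum_a independent_attack R t S a * f a = \sum_(i in S) #|S|%:R^-1 * f (i, t).
Proof.
transitivity (\sum_i \sum_s independent_attack R t S (i, s) * f (i, s)).
  by rewrite pair_bigA; apply: eq_bigr => -[].
rewrite [RHS]big_mkcond; apply: eq_bigr => i _ /=.
rewrite (bigD1 t) //= big1 ?addr0 => [|s ns]; rewrite ffunE /=.
  by rewrite eqxx andbT; case: ifP => //; rewrite mul0r.
by rewrite (negPf ns) andbF mul0r.
Qed.

Lemma independent_attack_mixed (t : 'I_T) (S : {set N}) :
  (0 < #|S|)%N -> mixed (independent_attack R t S).
Proof.
move=> S0; split=> [a|]; first by rewrite ffunE; case: ifP; rewrite ?invr_ge0.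
under eq_bigr do rewrite -[independent_attack _ _ _ _]mulr1.
rewrite independent_attack_sum sumr_const mulr1 -[LHS]mulr_natr mulVf //.
by rewrite pnatr_eq0 -lt0n.
Qed.

(* The two nodes visited during the attack interval are equal or adjacent, so
   at most one of them lies in [S]. *)
Lemma independent_attack_le (t : 'I_T) (S : {set N}) (w : patrol T e) :
  independent e S ->
  \sum_a independent_attack R t S a * patrol_payoff R w a <= #|S|%:R^-1.
Proof.
move=> indS; rewrite independent_attack_sum -mulr_sumr.
rewrite -[leRHS]mulr1 ler_wpM2l ?invr_ge0 //.
rewrite /patrol_payoff -natr_sum (ler_nat _ _ 1).
rewrite -big_mkcondr /= sum1_card.
apply/card_le1_eqP => i j /andP[iS iw] /andP[jS jw].
have e_in : (val w (ordS t) == val w t) || e (val w t) (val w (ordS t)).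
  by have /forallP := valP w; apply.
have indE a b : a \in S -> b \in S -> e a b = false.
  move=> aS bS; apply/negbTE.
  by move/forall_inP/(_ a aS)/forall_inP/(_ b bS): indS.
case/orP: iw jw => /eqP /= iE /orP[] /eqP /= jE; rewrite -iE -jE // in iS jS *.
  by case/orP: e_in => [/eqP //|]; rewrite indE.
by case/orP: e_in => [/eqP //|]; rewrite indE.
Qed.

End IndependentAttack.

(** * Interception probabilities of biased oscillations *)

Section Oscillations.
Variables (R : realType) (T : nat) (N : finType) (e : rel N).
Hypothesis T_odd : odd T.

(* The patrol repeating [a] at [s], [s + 1] is at [a] at the times [t] for which
   (t - s - 1) mod T is even; as [T] is odd, this is the parity test below. *)
Definition osc_phase (s t : 'I_T) : bool := (s < t)%N == odd (t + s).

Lemma osc_phase_id s : osc_phase s s.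
Proof. by rewrite /osc_phase ltnn addnn odd_double. Qed.

Lemma osc_phaseS s t : osc_phase s (ordS t) = (t == s) || ~~ osc_phase s t.
Proof.
rewrite /osc_phase -val_eqE /= modnS modn_small //.
case: s t => [s sT] [t tT] /=; case: ifP => [/dvdn_leq dT|_].
  (* Wrap-around from the last time to 0: here [t] is [T - 1], which is even because [T] is odd. *)
  have tE : T = t.+1 by apply/anti_leq; rewrite dT.
  have ev_t : odd t = false by apply/negbTE; rewrite -oddS -tE.
  rewrite ltn0 add0n oddD ev_t addFb.
  case: (ltngtP s t) => [_|st|->]; rewrite ?ev_t //=.
  by move: sT; rewrite tE ltnS leqNgt st.
rewrite addSn ltnS oddS oddD.
by case: (ltngtP s t) => [_|_|->]; rewrite /= ?addbb //;
  case: (odd _); case: (odd _).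
Qed.

Lemma ordS_invariant (f : 'I_T -> bool) :
  (forall t, f (ordS t) = f t) -> forall s t, f s = f t.
Proof.
move=> fS; suff f0 t : f t = f (Ordinal (odd_gt0 T_odd)).
  by move=> s t; rewrite !f0.
case: t; elim=> [|k IHk] kT; first by congr f; apply: val_inj.
rewrite -(IHk (ltnW kT)) -[RHS]fS; congr f; apply: val_inj => /=.
by rewrite modn_small.
Qed.

(** Alternation everywhere but at [s] determines the walk from its node at [s], and [osc_phase]
    writes it down. Hence each [s] contributes a single patrol to [right_osc]. *)
Lemma oscillates_unique (l r a : N) (s : 'I_T) :
  l != r -> e l r -> e r l -> (a == l) || (a == r) ->
  exists w : patrol T e, forall w', oscillates l r a s w' = (w' == w).
Proof.
move=> lr elr erl aP; pose b := if a == l then r else l.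
have [ab eab eba] : [/\ a != b, e a b & e b a].
  rewrite /b; case/orP: aP => /eqP->; first by rewrite eqxx.
  by rewrite [r == l]eq_sym (negPf lr) eq_sym.
have lrE x : (x == l) || (x == r) = (x == a) || (x == b).
  rewrite /b; case/orP: aP => /eqP->; first by rewrite eqxx.
  by rewrite [r == l]eq_sym (negPf lr) orbC.
pose w0 := [ffun t => if osc_phase s t then a else b].
have w0P : is_walk e w0.
  apply/forallP => t; rewrite !ffunE osc_phaseS.
  by case: (t == s); case: (osc_phase s t); rewrite /= ?eqxx ?eab ?eba ?orbT.
exists (exist _ w0 w0P) => w; apply/idP/eqP.
  case/and4P => /forallP wlr /eqP ws /eqP wSs /forallP walt.
  apply: val_inj; apply/ffunP => t /=; rewrite ffunE.
  (* Being at [a] and the phase both flip at every step except at [s], where both stay true; so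
     their difference is constant on the time circle. *)
  have fS t' : (val w (ordS t') == a) (+) osc_phase s (ordS t') =
               (val w t' == a) (+) osc_phase s t'.
    rewrite osc_phaseS; have [->|ts] /= := eqVneq t' s.
      by rewrite osc_phase_id ws wSs.
    have := walt t'; have := wlr t'; have := wlr (ordS t').
    rewrite /= ts !lrE /= => /orP[] /eqP-> /orP[] /eqP->; rewrite ?eqxx //;
    by rewrite ?[b == a]eq_sym ?(negPf ab); case: (osc_phase s t').
  have := ordS_invariant fS t s; rewrite ws eqxx osc_phase_id /=.
  have := wlr t; rewrite lrE; case: eqP => [-> _|_ /= /eqP->].
    by case: (osc_phase s t).
  by case: (osc_phase s t).
move=> ->; apply/and4P; split=> /=.
- by apply/forallP => t; rewrite ffunE lrE; case: ifP; rewrite eqxx ?orbT.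
- by rewrite ffunE osc_phase_id.
- by rewrite ffunE osc_phaseS eqxx.
apply/forallP => t; apply/implyP => ts; rewrite !ffunE osc_phaseS (negPf ts) /=.
by case: (osc_phase s t); rewrite // eq_sym.
Qed.

Variables (l r : N).
Hypotheses (lr : l != r) (elr : e l r) (erl : e r l).

(** Turns an expectation over all patrols into an average over the repetition time. *)
Lemma right_osc_sum : exists Wr Wl : 'I_T -> patrol T e,
  [/\ forall s, oscillates l r r s (Wr s), forall s, oscillates l r l s (Wl s)
    & forall p (f : patrol T e -> R), \sum_w right_osc T e p l r w * f w =
        \sum_(s < T) T%:R^-1 * (p * f (Wr s) + (1 - p) * f (Wl s))].
Proof.
have /fin_all_exists[Wr WrE] : forall s, exists W : patrol T e, forall w,
    oscillates l r r s w = (w == W).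
  by move=> s; apply: oscillates_unique; rewrite // eqxx orbT.
have /fin_all_exists[Wl WlE] : forall s, exists W : patrol T e, forall w,
    oscillates l r l s w = (w == W).
  by move=> s; apply: oscillates_unique; rewrite // eqxx.
exists Wr, Wl; split=> [s|s|p f]; rewrite ?WrE ?WlE //.
under eq_bigr do rewrite ffunE mulr_suml.
rewrite exchange_big; apply: eq_bigr => s _ /=.
have pick w0 : \sum_w (w == w0)%:R * f w = f w0.
  rewrite (bigD1 w0) //= eqxx mul1r big1 ?addr0 // => w /negPf->.
  by rewrite mul0r.
rewrite -[f (Wr s)]pick -[f (Wl s)]pick !mulr_sumr -big_split mulr_sumr /=.
by apply: eq_bigr => w _; rewrite WrE WlE; ring.
Qed.

Let Tn0 : T%:R != 0 :> R.
Proof. by rewrite pnatr_eq0 -lt0n odd_gt0. Qed.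

Lemma right_osc_mixed p :
  0 <= p <= 1 -> mixed (right_osc T e p l r : {ffun _ -> R}).
Proof.
case/andP=> p0 p1; split=> [w|].
  rewrite ffunE; apply: sumr_ge0 => s _.
  by rewrite mulr_ge0 ?invr_ge0 // addr_ge0 ?mulr_ge0 // subr_ge0.
have [Wr [Wl [_ _ E]]] := right_osc_sum.
under eq_bigr do rewrite -[right_osc _ _ _ _ _ _]mulr1.
rewrite E; under eq_bigr do rewrite !mulr1 addrC subrK mulr1.
by rewrite sumr_const card_ord -[LHS]mulr_natr mulVf.
Qed.

Lemma oscillates_intercepts (a : N) (s t : 'I_T) (w : patrol T e) :
  (a == l) || (a == r) -> oscillates l r a s w -> intercepts w (a, t).
Proof.
move=> aP /and4P[/forallP wlr /eqP ws _ /forallP walt]; rewrite /intercepts /=.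
have [->|ts] := eqVneq t s; first by rewrite ws eqxx.
have := walt t; have := wlr t; have := wlr (ordS t); rewrite /= ts /=.
by case/orP: aP => /eqP-> /orP[] /eqP-> /orP[] /eqP->; rewrite ?eqxx ?orbT.
Qed.

(** Away from [s] the walk changes node, so it visits both [l] and [r] during the interval. *)
Lemma oscillates_intercepts_other (a b : N) (s t : 'I_T) (w : patrol T e) :
  (b == l) || (b == r) -> oscillates l r a s w -> t != s -> intercepts w (b, t).
Proof.
move=> bP /and4P[/forallP wlr _ _ /forallP walt] ts; rewrite /intercepts /=.
have := walt t; have := wlr t; have := wlr (ordS t); rewrite /= ts /=.
by case/orP: bP => /eqP-> /orP[] /eqP-> /orP[] /eqP->; rewrite ?eqxx ?orbT.
Qed.

(** Here [x] is the weight of the patrol that never misses, and [y] that of the one missing only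
    when the repetition falls on the attack, which has probability [1 / T]. *)
Lemma sum_neq (t : 'I_T) (x y : R) :
  \sum_(s < T) T%:R^-1 * (x + y * (t != s)%:R) = x + y - y / T%:R.
Proof.
have -> : \sum_(s < T) T%:R^-1 * (x + y * (t != s)%:R) =
    \sum_(s < T) (T%:R^-1 * (x + y) - y / T%:R * (t == s)%:R).
  by apply: eq_bigr => s _; case: eqP => _ /=; field.
rewrite big_split /= sumr_const card_ord -[_ *+ T]mulr_natr sumrN -mulr_sumr.
rewrite (bigD1 t) //= big1 => [|s]; first by rewrite eqxx mulr1n; field.
by rewrite eq_sym => /negPf->.
Qed.

Lemma right_osc_ge_right (t : 'I_T) p : 0 <= p <= 1 ->
  1 - (1 - p) / T%:R <= \sum_w right_osc T e p l r w * patrol_payoff R w (r, t).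
Proof.
case/andP=> p0 p1; have [Wr [Wl [WrP WlP ->]]] := right_osc_sum.
have -> : 1 - (1 - p) / T%:R = p + (1 - p) - (1 - p) / T%:R by ring.
rewrite -(sum_neq t); apply: ler_sum => s _.
rewrite ler_wpM2l ?invr_ge0 // /patrol_payoff.
rewrite (oscillates_intercepts _ _ (WrP s)) ?eqxx ?orbT // mulr1 lerD2l.
rewrite ler_wpM2l ?subr_ge0 // ler_nat; case: (boolP (t != s)) => // ts.
by rewrite (oscillates_intercepts_other _ (WlP s)) ?eqxx ?orbT.
Qed.

Lemma right_osc_ge_left (t : 'I_T) p : 0 <= p <= 1 ->
  1 - p / T%:R <= \sum_w right_osc T e p l r w * patrol_payoff R w (l, t).
Proof.
case/andP=> p0 p1; have [Wr [Wl [WrP WlP ->]]] := right_osc_sum.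
have -> : 1 - p / T%:R = (1 - p) + p - p / T%:R by ring.
rewrite -(sum_neq t); apply: ler_sum => s _.
rewrite ler_wpM2l ?invr_ge0 // /patrol_payoff.
rewrite (oscillates_intercepts _ _ (WlP s)) ?eqxx // mulr1 [leRHS]addrC lerD2l.
rewrite ler_wpM2l // ler_nat; case: (boolP (t != s)) => // ts.
by rewrite (oscillates_intercepts_other _ (WrP s)) ?eqxx ?orbT.
Qed.

End Oscillations.

(** * A large independent set of the line graph *)

Section EvenNodes.
Variable n : nat.

(* These are the odd-numbered nodes of the paper, which counts from 1. *)
Definition even_nodes : {set 'I_n} := [set i : 'I_n | ~~ odd i].

Lemma even_nodes_independent : independent (line_edge n) even_nodes.
Proof.
apply/forall_inP => i; rewrite inE => oi.
apply/forall_inP => j; rewrite inE => oj.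
rewrite /line_edge; apply/negP => /orP[] /eqP E; move: oi oj;
  by rewrite E /=; case: (odd _).
Qed.

Lemma even_nodes_card : ((n.+1)./2 <= #|even_nodes|)%N.
Proof.
have lt2 (k : 'I_(n.+1)./2) : (k.*2 < n)%N by case: k => k kn /=; lia.
have inj : injective (fun k => Ordinal (lt2 k)).
  by move=> j k [] /double_inj /val_inj.
rewrite -[X in (X <= _)%N]card_ord -(card_imset _ inj).
apply: subset_leq_card; apply/fintype.subsetP => _ /imsetP[k _ ->].
by rewrite inE /= odd_double.
Qed.

End EvenNodes.

Lemma half_succ (R : realType) (n : nat) :
  odd n -> (n.+1)./2%:R^-1 = 2 / (n%:R + 1) :> R.
Proof.
move=> n_odd.
have -> : n%:R + 1 = (n.+1)./2%:R * 2 :> R.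
  by rewrite -natrM natr1 muln2; congr _%:R; lia.
have h0 : (n.+1)./2%:R != 0 :> R by rewrite pnatr_eq0; lia.
by field.
Qed.

(** * Edge weights and the covering of the nodes *)

Section LineGraph.
Variables (R : realType) (T n : nat).
Hypotheses (T_odd : odd T) (n_odd : odd n) (n_ge2 : (2 <= n)%N).
Hypothesis n_le : (n <= 2 * T - 1)%N.

(* Up to normalization, the probability of the edge {j, j+1}, on which the left
   node is repeated if [j] is even and the right node if [j] is odd. *)
Definition edge_weight (j : nat) : nat :=
  if odd j then (if j.+2 == n then T.-1 else (j./2).+1) else (T.-1 - j./2)%N.

(** Edges [2k] and [2k+1] weigh [(T-1-k) + (k+1) = T] together, except in the last pair, where the
    second weight is raised to [T-1]. *)
Lemma edge_weight_sum : (\sum_(j < n.-1) edge_weight j = (n.+1)./2 * T.-1)%N.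
Proof.
have pre m : (m.*2 < n.-1)%N ->
    (\sum_(j < m.*2) edge_weight j = m * T)%N.
  elim: m => [|m IHm] mn; first by rewrite big_ord0.
  rewrite doubleS !big_ord_recr /= IHm ?doubleS; last by lia.
  rewrite /edge_weight /= odd_double /= ifN; last by lia.
  by rewrite doubleK uphalf_double; nia.
(* This [m] counts the ordinary pairs. The total is [m * T + (T-1-m) + (T-1) = (m+2) * (T-1)]; the
   subtraction is exact since [n <= 2T-1] gives [m <= T-2]. *)
have [m nE] : exists m, n = m.*2.+3 by exists (n - 3)./2; lia.
have -> : n.-1 = m.*2.+2 by rewrite nE.
rewrite !big_ord_recr /= pre; last by lia.
rewrite /edge_weight /= odd_double /= nE eqxx doubleK.
by move: n_le; rewrite nE; nia.
Qed.

(** At an interior node [2k] the two weights are [T-1-k] and [k]; each end node has one edge, of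
    weight [T-1]. The boolean factors discard the absent edges. *)
Lemma edge_weight_even j : (j < n)%N -> ~~ odd j ->
  (T.-1 <= (j.+1 < n) * edge_weight j + (0 < j) * edge_weight j.-1)%N.
Proof.
move=> jn ej; rewrite /edge_weight (negPf ej).
case: j => [|j] in jn ej *; first by rewrite n_ge2 /=; lia.
rewrite /= negbK in ej *; rewrite ej.
case: eqP => [E|jn']; first by lia.
have -> : (j.+2 < n)%N by lia.
lia.
Qed.

(** Odd nodes are never repeated, so their weight counts only with factor [1 - 1/T]; they need [T]
    to reach [T-1]. *)
Lemma edge_weight_odd j : (j.+1 < n)%N -> odd j ->
  (T <= edge_weight j + edge_weight j.-1)%N.
Proof.
case: j => // j jn oj; rewrite /edge_weight oj /=.
rewrite /= in oj; rewrite (negPf oj) uphalf_half (negPf oj).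
by case: eqP => _; lia.
Qed.

Lemma sum_delta (m i : nat) (f : nat -> R) :
  \sum_(j < m) (i == j)%:R * f j = (i < m)%:R * f i.
Proof.
case: ltnP => im.
  rewrite (bigD1 (Ordinal im)) //= eqxx big1 ?addr0 // => j /negPf ji.
  by rewrite eq_sym -[i]/(val (Ordinal im)) val_eqE ji mul0r.
rewrite mul0r big1 // => j _; rewrite gtn_eqF ?mul0r //.
exact: leq_trans (ltn_ord j) im.
Qed.

Definition edge_prob (j : nat) : R :=
  (edge_weight j)%:R / ((n.+1)./2 * T.-1)%:R.

Let T_gt1 : (1 < T)%N.
Proof. by move: n_le n_ge2 n_odd; case: n => [|[|[|]]] // *; lia. Qed.

Let norm_gt0 : 0 < ((n.+1)./2 * T.-1)%:R :> R.
Proof. by rewrite ltr0n muln_gt0; lia. Qed.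

Lemma edge_prob_mixed : mixed [ffun j : 'I_n.-1 => edge_prob j].
Proof.
split=> [j|]; first by rewrite ffunE divr_ge0.
under eq_bigr do rewrite ffunE.
by rewrite -mulr_suml -natr_sum edge_weight_sum mulfV ?gt_eqF.
Qed.

(** The two terms bound the interception at node [i] by the oscillations on its right and left
    edges. Both factors are [1 - 1/T] for odd [i] and 1 for even [i]. *)
Lemma edge_prob_cover (i : nat) : (i < n)%N ->
  (n.+1)./2%:R^-1 <=
    (i.+1 < n)%:R * (edge_prob i * (1 - (odd i)%:R / T%:R)) +
    (0 < i)%:R * (edge_prob i.-1 * (1 - (1 - (odd i.-1)%:R) / T%:R)).
Proof.
move=> i_n; have T0 : T%:R != 0 :> R by rewrite pnatr_eq0; lia.
have TE : T.-1%:R = T%:R - 1 :> R by rewrite -subn1 natrB //; lia.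
have m0 : (n.+1)./2%:R != 0 :> R by rewrite pnatr_eq0; lia.
have T10 : T%:R - 1 != 0 :> R by rewrite -TE pnatr_eq0; lia.
have [oi|ei] := boolP (odd i).
  have i_n1 : (i.+1 < n)%N by move: n_odd oi i_n; lia.
  have i0 : (0 < i)%N by case: (i) oi.
  have oi' : odd i.-1 = false by case: (i) oi => //= k /negPf.
  have := edge_weight_odd i_n1 oi; rewrite -(ler_nat R) natrD => W.
  rewrite i_n1 i0 oi' /edge_prob natrM TE.
  have -> : (n.+1)./2%:R^-1 =
      T%:R * ((1 - T%:R^-1) / ((n.+1)./2%:R * (T%:R - 1))) :> R.
    by field; rewrite m0 T0 T10.
  have -> : true%:R * ((edge_weight i)%:R / ((n.+1)./2%:R * (T%:R - 1)) *
        (1 - true%:R / T%:R)) +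
      true%:R * ((edge_weight i.-1)%:R / ((n.+1)./2%:R * (T%:R - 1)) *
        (1 - (1 - false%:R) / T%:R)) =
      ((edge_weight i)%:R + (edge_weight i.-1)%:R) *
        ((1 - T%:R^-1) / ((n.+1)./2%:R * (T%:R - 1))) :> R.
    by rewrite mulr1n mulr0n; field; rewrite m0 T0 T10.
  rewrite ler_wpM2r // divr_ge0 //.
    by rewrite subr_ge0 invf_le1 ?ler1n ?ltr0n; lia.
  by rewrite -TE -natrM.
have := edge_weight_even i_n ei; rewrite -(ler_nat R) natrD !natrM => W.
have -> : (n.+1)./2%:R^-1 = T.-1%:R / ((n.+1)./2 * T.-1)%:R :> R.
  by rewrite natrM TE; field; rewrite m0 T10.
(* At [i = 0] the guard kills the spurious edge [i.-1 = 0]; otherwise [i.-1] is odd and the factor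
   is 1. *)
have -> : (0 < i)%:R * (edge_prob i.-1 * (1 - (1 - (odd i.-1)%:R) / T%:R)) =
    (0 < i)%:R * edge_prob i.-1.
  case: (i) ei => [|k] /=; first by rewrite !mul0r.
  by rewrite negbK => ->; rewrite subrr mul0r subr0 mulr1.
rewrite mul0r subr0 mulr1 /edge_prob !mulrA -mulrDl.
by apply: ler_wpM2r; rewrite ?invr_ge0.
Qed.

(** * The Patroller's mixture of oscillations *)

Lemma line_edge_sym (i j : 'I_n) : line_edge n i j = line_edge n j i.
Proof. by rewrite /line_edge orbC. Qed.

Definition edge_left (j : 'I_n.-1) : 'I_n := widen_ord (leq_pred n) j.

Lemma edge_right_subproof (j : 'I_n.-1) : (j.+1 < n)%N.
Proof. by rewrite -ltn_predRL. Qed.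

Definition edge_right (j : 'I_n.-1) : 'I_n := Ordinal (edge_right_subproof j).

(** The bias is 0 or 1, chosen so that the repeated node is always the even one. *)
Definition edge_osc (j : 'I_n.-1) : {ffun patrol T (line_edge n) -> R} :=
  right_osc T (line_edge n) (odd j)%:R (edge_left j) (edge_right j).

Definition osc_mixture : {ffun patrol T (line_edge n) -> R} :=
  [ffun w => \sum_(j < n.-1) edge_prob j * edge_osc j w].

Let odd01 (j : nat) : 0 <= ((odd j)%:R : R) <= 1.
Proof. by case: (odd j); rewrite lexx ler01. Qed.

Let lr (j : 'I_n.-1) : edge_left j != edge_right j.
Proof. by rewrite -val_eqE /= neq_ltn ltnSn. Qed.

Let elr (j : 'I_n.-1) : line_edge n (edge_left j) (edge_right j).
Proof. by rewrite /line_edge eqxx. Qed.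

Let erl (j : 'I_n.-1) : line_edge n (edge_right j) (edge_left j).
Proof. by rewrite line_edge_sym. Qed.

Lemma osc_mixture_sum (f : patrol T (line_edge n) -> R) :
  \sum_w osc_mixture w * f w =
    \sum_(j < n.-1) edge_prob j * \sum_w edge_osc j w * f w.
Proof.
under eq_bigr do rewrite ffunE mulr_suml.
rewrite exchange_big; apply: eq_bigr => j _ /=.
by rewrite mulr_sumr; apply: eq_bigr => w _; rewrite mulrA.
Qed.

Lemma osc_mixture_mixed : mixed osc_mixture.
Proof.
have osc_mixed j : mixed (edge_osc j) by apply: right_osc_mixed.
have [c0 c1] := edge_prob_mixed; split=> [w|].
  rewrite ffunE; apply: sumr_ge0 => j _; apply: mulr_ge0.
    by have := c0 j; rewrite ffunE.
  by have [b0 _] := osc_mixed j.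
under eq_bigr do rewrite -[osc_mixture _]mulr1.
rewrite osc_mixture_sum -[RHS]c1; apply: eq_bigr => j _; rewrite [RHS]ffunE.
under eq_bigr do rewrite mulr1.
by have [_ ->] := osc_mixed j; rewrite mulr1.
Qed.

Lemma osc_mixtureP : oscillation_mixture osc_mixture.
Proof.
exists n.-1, [ffun j : 'I_n.-1 => edge_prob j], edge_osc; split.
- exact: edge_prob_mixed.
- move=> j; exists (odd j)%:R, (edge_left j), (edge_right j).
  by split=> //; left.
by move=> w; rewrite ffunE; apply: eq_bigr => j _; congr (_ * _); rewrite ffunE.
Qed.

(** Written with indicators so that one bound serves nodes on and off the edge and the sum over [j]
    collapses by [sum_delta]. *)
Lemma edge_osc_ge (j : 'I_n.-1) (i : 'I_n) (t : 'I_T) :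
  (i == j :> nat)%:R * (1 - (odd j)%:R / T%:R) +
  (i == j.+1 :> nat)%:R * (1 - (1 - (odd j)%:R) / T%:R) <=
  \sum_w edge_osc j w * patrol_payoff R w (i, t).
Proof.
have [ij|nij] := eqVneq (i : nat) j.
  rewrite ij ltn_eqF // mul1r mul0r addr0.
  have -> : i = edge_left j by apply: val_inj.
  exact: right_osc_ge_left.
rewrite mul0r add0r; have [ij|nij'] := eqVneq (i : nat) j.+1.
  rewrite mul1r; have -> : i = edge_right j by apply: val_inj.
  exact: right_osc_ge_right.
rewrite mul0r; apply: sumr_ge0 => w _.
have [b0 _] : mixed (edge_osc j) by apply: right_osc_mixed.
by rewrite mulr_ge0.
Qed.

Lemma osc_mixture_ge (a : attack T 'I_n) :
  (n.+1)./2%:R^-1 <= \sum_w osc_mixture w * patrol_payoff R w a.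
Proof.
case: a => i t; rewrite osc_mixture_sum.
apply: le_trans (edge_prob_cover (ltn_ord i)) _.
pose A j := edge_prob j * (1 - (odd j)%:R / T%:R).
pose B j := edge_prob j * (1 - (1 - (odd j)%:R) / T%:R).
apply: (@le_trans _ _ (\sum_(j < n.-1) ((i == j :> nat)%:R * A j +
                                        (i == j.+1 :> nat)%:R * B j))).
  rewrite big_split /= sum_delta ltn_predRL lerD2l.
  (* Node 0 has no left edge; for [i = k+1] the second sum picks out edge [k]. *)
  case: (i : nat) (ltn_ord i) => [|k] kn.
    by rewrite mul0r sumr_ge0 // => j _; rewrite mul0r.
  under eq_bigr do rewrite eqSS.
  by rewrite sum_delta ltn_predRL kn.
apply: ler_sum => j _; rewrite ![_ * (edge_prob j * _)]mulrCA -mulrDr.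
by rewrite ler_wpM2l ?edge_osc_ge // divr_ge0.
Qed.

End LineGraph.

(** * Value and optimal strategies on the line graph *)

Theorem proposition10 (R : realType) (T n : nat)
    (T_ge2 : (2 <= T)%N) (n_ge2 : (2 <= n)%N) (T_odd : odd T) (n_odd : odd n)
    (n_le : (n <= 2 * T - 1)%N) :
  let u := @patrol_payoff R T 'I_n (line_edge n) in
  [/\ is_value u (2 / (n%:R + 1)),
      forall (t : 'I_T) (S : {set 'I_n}),
        max_independent (line_edge n) S ->
        optimal_min u (independent_attack R t S)
    & exists2 x : {ffun patrol T (line_edge n) -> R},
        optimal_max u x & oscillation_mixture x].
Proof.
move=> u; pose x := osc_mixture R T n.
(* Any independent set with at least [(n+1)/2] nodes forms a saddle point with [x]. The even nodes
   yield the value, and a maximum independent set is at least as large as they are. *)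
have saddle (t : 'I_T) (S : {set 'I_n}) :
    independent (line_edge n) S -> ((n.+1)./2 <= #|S|)%N ->
    [/\ is_value u (2 / (n%:R + 1)), optimal_max u x
      & optimal_min u (independent_attack R t S)].
  move=> indS leS; have S0 : (0 < #|S|)%N by apply: leq_trans leS; lia.
  rewrite -half_succ //; apply: saddle_point.
  - exact: osc_mixture_mixed.
  - exact: independent_attack_mixed.
  - exact: osc_mixture_ge.
  move=> w; apply: le_trans (independent_attack_le R t w indS) _.
  by rewrite lef_pV2 ?posrE ?ltr0n ?ler_nat //; lia.
have even_card := even_nodes_card n.
have indE := even_nodes_independent n.
have [] := saddle (Ordinal (odd_gt0 T_odd)) _ indE even_card.
move=> val_u opt_x _; split=> // [t S [indS maxS]|].
  have le_S := leq_trans even_card (maxS _ indE).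
  by have [] := saddle t S indS le_S.
by exists x; rewrite // /x; apply: osc_mixtureP.
Qed.
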